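(* Let $H_0:\mathbb{R}^{d_1}\to\mathbb{R}$ be $\rho$-strongly concave and $L$-smooth ($\rho,L>0$), let $H_1,\dots,H_m:\mathbb{R}^{d_1}\to\mathbb{R}$ be continuously differentiable and convex, $\mathcal X=\{x: H_i(x)\le0,\ i=1,\dots,m\}$, let $A\in\mathbb{R}^{d_2\times d_1}$, $b_0\in\mathbb{R}^{d_2}$, and suppose there exists $x$ with $H_i(x)<0$ for $i=1,\dots,m$ and $Ax=b_0$. Assume moreover that $A$ has full row rank. Then: (a) the map $\lambda\mapsto -Ax^*(\lambda)$ on $\mathbb{R}^{d_2}$ is strongly monotone; (b) the map $\lambda\mapsto -A\hat x(\lambda)$ on $\mathbb{R}^{d_2}$ is co-coercive.
   Context: For $\lambda\in\mathbb{R}^{d_2}$, $x^*(\lambda)\in\mathbb{R}^{d_1}$ is the unique solution $x$ of $\nabla H_0(x)-A^T\lambda=0$, and $\hat x(\lambda)$ is the unique solution $x$ of $x=\mathcal{P}_{\mathcal X}\big(x+\nabla H_0(x)-A^T\lambda\big)$, where $\mathcal{P}_{\mathcal X}$ is the Euclidean projection onto $\mathcal X$. $L$-smooth means differentiable with $L$-Lipschitz gradient. A map $T:\mathbb{R}^d\to\mathbb{R}^d$ is strongly monotone if there is $c>0$ with $\langle T(u)-T(v),u-v\rangle\ge c\|u-v\|^2$ for all $u,v$, and co-coercive if there is $c>0$ with $\langle T(u)-T(v),u-v\rangle\ge c\|T(u)-T(v)\|^2$ for all $u,v$. *)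

(* Defs.v *)
From mathcomp Require Import all_boot all_order all_algebra.
From mathcomp Require Import all_classical all_reals all_analysis.

Set Implicit Arguments.
Unset Strict Implicit.
Unset Printing Implicit Defensive.

Import Order.TTheory GRing.Theory Num.Theory.
Import numFieldNormedType.Exports.

Local Open Scope classical_set_scope.
Local Open Scope ring_scope.

(* The library norm `|_| on matrices is the sup norm; every metric notion below
   is stated with the Euclidean inner product and norm instead. Topological
   notions ([continuous], [differentiable]) do not depend on this choice. *)
Definition dotp (R : realType) d (u v : 'cV[R]_d) : R :=
  \sum_(i < d) u i 0 * v i 0.

Definition enorm (R : realType) d (u : 'cV[R]_d) : R := Num.sqrt (dotp u u).

(* The vector of partial derivatives; it represents the differential only where
   [f] is differentiable, which the users of [grad] require separately. *)
Definition grad (R : realType) d (f : 'cV[R]_d -> R) (x : 'cV[R]_d) : 'cV[R]_d :=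
  \col_(i < d) 'D_(delta_mx i 0) f x.

Definition L_smooth (R : realType) d (L : R) (f : 'cV[R]_d -> R) : Prop :=
  (forall x, differentiable f x) /\
  (forall x y, enorm (grad f x - grad f y) <= L * enorm (x - y)).

Definition continuously_differentiable (R : realType) d
    (f : 'cV[R]_d -> R) : Prop :=
  (forall x, differentiable f x) /\ continuous (grad f).

Definition strongly_concave (R : realType) d (rho : R)
    (f : 'cV[R]_d -> R) : Prop :=
  forall (x y : 'cV[R]_d) (t : R), 0 <= t -> t <= 1 ->
    t * f x + (1 - t) * f y + rho / 2 * t * (1 - t) * enorm (x - y) ^+ 2
      <= f (t *: x + (1 - t) *: y).

Definition feasible (R : realType) d m (H : 'I_m -> 'cV[R]_d -> R) :
    set 'cV[R]_d :=
  [set x | forall i, H i x <= 0].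

(* [proj], [xstar] and [xhat] are total: [xget] picks an element of the given
   set, with 0 as a junk value when the set is empty. *)
Definition proj (R : realType) d (X : set 'cV[R]_d) (z : 'cV[R]_d) : 'cV[R]_d :=
  xget 0 [set y | X y /\ forall w, X w -> enorm (z - y) <= enorm (z - w)].

Definition xstar (R : realType) d1 d2 (H0 : 'cV[R]_d1 -> R)
    (A : 'M[R]_(d2, d1)) (lambda : 'cV[R]_d2) : 'cV[R]_d1 :=
  xget 0 [set x | grad H0 x - A^T *m lambda = 0].

Definition xhat (R : realType) d1 d2 (H0 : 'cV[R]_d1 -> R)
    (X : set 'cV[R]_d1) (A : 'M[R]_(d2, d1)) (lambda : 'cV[R]_d2) : 'cV[R]_d1 :=
  xget 0 [set x | x = proj X (x + grad H0 x - A^T *m lambda)].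

Definition strongly_monotone (R : realType) d (T : 'cV[R]_d -> 'cV[R]_d) : Prop :=
  exists2 c : R, 0 < c &
    forall u v, c * enorm (u - v) ^+ 2 <= dotp (T u - T v) (u - v).

Definition cocoercive (R : realType) d (T : 'cV[R]_d -> 'cV[R]_d) : Prop :=
  exists2 c : R, 0 < c &
    forall u v, c * enorm (T u - T v) ^+ 2 <= dotp (T u - T v) (u - v).

(* Main.v *)
Require Import Defs.
From mathcomp Require Import all_boot all_order all_algebra.
From mathcomp Require Import all_classical all_reals all_analysis.
From mathcomp Require Import ring lra.

Set Implicit Arguments.
Unset Strict Implicit.
Unset Printing Implicit Defensive.

Import Order.TTheory GRing.Theory Num.Theory.
Import numFieldNormedType.Exports.

Local Open Scope classical_set_scope.
Local Open Scope ring_scope.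

(** Maximizing the strongly concave function H0 - <A^T lambda, .> over a closed
    convex set X gives a solution of the variational inequality
    <grad H0 x - A^T lambda, w - x> <= 0 for w in X; this solves the equation of
    x* when X is the whole space and, since projections are themselves
    characterized by a variational inequality, that of xhat when X is the
    feasible set.  With p, q the solutions for u, v, testing the first inequality
    at q and the second at p, strong concavity gives
      - <A (p - q), u - v> >= - <grad H0 p - grad H0 q, p - q> >= rho |p - q|^2.
    For xhat, |A (p - q)|^2 <= K |p - q|^2 concludes.  For x*, the Lipschitz bound
    gives |A^T (u - v)| <= L |p - q|, and A^T has a left inverse as A has full
    row rank. *)

(** * Euclidean inner product and matrix bounds *)

Section Dotp.
Variables (R : realType) (d : nat).
Implicit Types (u v w : 'cV[R]_d) (a : R).

Lemma dotpC u v : dotp u v = dotp v u.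
Proof. by apply: eq_bigr => i _; rewrite mulrC. Qed.

Lemma dotpDl u v w : dotp (u + v) w = dotp u w + dotp v w.
Proof. by rewrite -big_split; apply: eq_bigr => i _; rewrite mxE mulrDl. Qed.

Lemma dotpZl a u v : dotp (a *: u) v = a * dotp u v.
Proof. by rewrite mulr_sumr; apply: eq_bigr => i _; rewrite mxE mulrA. Qed.

Lemma dotpNl u v : dotp (- u) v = - dotp u v.
Proof. by rewrite -scaleN1r dotpZl mulN1r. Qed.

Lemma dotpDr u v w : dotp w (u + v) = dotp w u + dotp w v.
Proof. by rewrite dotpC dotpDl !(dotpC w). Qed.

Lemma dotpZr a u v : dotp u (a *: v) = a * dotp u v.
Proof. by rewrite dotpC dotpZl (dotpC u). Qed.

Lemma dotpNr u v : dotp u (- v) = - dotp u v.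
Proof. by rewrite dotpC dotpNl (dotpC u). Qed.

Definition dotpE := (dotpDl, dotpDr, dotpZl, dotpZr, dotpNl, dotpNr).

Lemma dotp_ge0 u : 0 <= dotp u u.
Proof. by apply: sumr_ge0 => i _; rewrite -expr2 sqr_ge0. Qed.

Lemma dotp_eq0 u : dotp u u = 0 -> u = 0.
Proof.
move=> /eqP; rewrite psumr_eq0 => [|i _]; last by rewrite -expr2 sqr_ge0.
move=> /allP u0; apply/colP => i; rewrite mxE; apply/eqP.
by have := u0 i (mem_index_enum i); rewrite mulf_eq0 orbb.
Qed.

Lemma sqr_enorm u : enorm u ^+ 2 = dotp u u.
Proof. exact: sqr_sqrtr (dotp_ge0 u). Qed.

Lemma ler_enorm u v : (enorm u <= enorm v) = (dotp u u <= dotp v v).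
Proof. exact: ler_sqrt (dotp_ge0 v). Qed.

(** For nonzero [v], expand the squared norm of |v|^2 u - <u, v> v and cancel one factor |v|^2. *)
Lemma cauchy_schwarz_dotp u v : dotp u v ^+ 2 <= dotp u u * dotp v v.
Proof.
have [/dotp_eq0 ->|v_neq0] := eqVneq (dotp v v) 0.
  by rewrite -(scale0r v) !dotpE !mul0r mulr0 expr0n.
have v_gt0 : 0 < dotp v v by rewrite lt_def v_neq0 dotp_ge0.
have := dotp_ge0 (dotp v v *: u - dotp u v *: v).
rewrite -scaleNr !dotpE (dotpC v u) => h.
rewrite -subr_ge0 -(pmulr_rge0 _ v_gt0).
by apply: le_trans h _; rewrite le_eqVlt; apply/orP; left; apply/eqP; ring.
Qed.

Lemma dotp_sqrD u v : dotp (u + v) (u + v) <= 2 * dotp u u + 2 * dotp v v.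
Proof. by have := dotp_ge0 (u - v); rewrite !dotpE (dotpC v u); lra. Qed.

(** Expand |u - v/a|^2 >= 0. This later bounds superlevel sets of strongly concave functions. *)
Lemma dotp_sqr_le u v a : 0 < a -> a * dotp u u <= dotp v u ->
  dotp u u <= (a ^- 2) * dotp v v.
Proof.
move=> a_gt0 h; have := dotp_ge0 (u - a^-1 *: v).
rewrite -scaleNr !dotpE (dotpC u v) -exprVn expr2.
have : a^-1 * (a * dotp u u) <= a^-1 * dotp v u by rewrite ler_pM2l ?invr_gt0.
rewrite mulKf ?gt_eqF//; lra.
Qed.

End Dotp.

Lemma dotp_mulmx (R : realType) m n (A : 'M[R]_(m, n)) u v :
  dotp (A *m u) v = dotp u (A^T *m v).
Proof.
rewrite /dotp; under eq_bigr do rewrite mxE mulr_suml.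
rewrite exchange_big; apply: eq_bigr => j _; rewrite mxE mulr_sumr.
by apply: eq_bigr => i _; rewrite mxE; ring.
Qed.

Lemma mulmx_dotp_bounded (R : realType) m n (A : 'M[R]_(m, n)) :
  exists2 K : R, 0 < K & forall u, dotp (A *m u) (A *m u) <= K * dotp u u.
Proof.
(* [S] is the squared Frobenius norm of [A]; Cauchy-Schwarz on each row gives the bound, and adding
   1 keeps the constant positive when [A] is zero. *)
pose S := \sum_(i < m) dotp (row i A)^T (row i A)^T.
have S_ge0 : 0 <= S by apply: sumr_ge0 => i _; exact: dotp_ge0.
exists (S + 1) => [|u]; first by lra.
apply: (@le_trans _ _ (S * dotp u u)); last first.
  by rewrite ler_wpM2r ?dotp_ge0// lerDl.
rewrite mulr_suml; apply: ler_sum => i _.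
have -> : (A *m u) i 0 = dotp (row i A)^T u.
  by rewrite mxE; apply: eq_bigr => j _; rewrite !mxE.
by rewrite -expr2 cauchy_schwarz_dotp.
Qed.

(** * Directional derivatives and first-order inequalities *)

Section Derivative.
Variables (R : realType) (d : nat).
Implicit Types (f : 'cV[R]_d -> R) (x y v : 'cV[R]_d).

Lemma derive_grad f x v : differentiable f x -> 'D_v f x = dotp (grad f x) v.
Proof.
move=> df; rewrite deriveE//.
have -> : v = \sum_(i < d) v i 0 *: delta_mx i 0.
  by rewrite {1}[v]matrix_sum_delta; apply: eq_bigr => i _; rewrite big_ord1.
rewrite linear_sum; apply: eq_bigr => i _.
rewrite linearZ/= mxE deriveE// mulrC; congr (_ * _).
rewrite summxE (bigD1 i)//= big1 => [|j ji]; rewrite !mxE ?eqxx/= ?mulr1 ?addr0//.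
by rewrite eq_sym (negbTE ji) mulr0.
Qed.

(** The difference quotients are at least [a - k * t]; let [t] tend to 0 from the right. The term in
    [k] accommodates the quadratic part of strong concavity. *)
Lemma derive_ge f x v (a k : R) : derivable f x v ->
  (forall t, 0 < t -> t < 1 -> t * (a - k * t) <= f (x + t *: v) - f x) ->
  a <= 'D_v f x.
Proof.
move=> df H.
have h1 : (a - k * t) @[t --> 0^'+] --> a.
  have : (a - k * t) @[t --> 0^'] --> a - k * 0.
    apply: cvg_within_filter.
    by apply: cvgB; [exact: cvg_cst|apply: cvgM; [exact: cvg_cst|exact: cvg_id]].
  by rewrite mulr0 subr0; exact: cvg_dnbhs_at_right.
have h2 := cvg_dnbhs_at_right df.
apply: (ler_cvg_to h1 h2).
near=> t.
have t_gt0 : 0 < t by near: t; exact: nbhs_right_gt.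
have t_lt1 : t < 1 by near: t; exact: nbhs_right_lt.
rewrite /GRing.scale/= -(ler_pM2l t_gt0) mulVKf ?gt_eqF//.
by rewrite (addrC (t *: v)) H.
Unshelve. all: by end_near. Qed.

Lemma strongly_concave_grad f rho x y : strongly_concave rho f ->
  differentiable f y ->
  f x - f y + rho / 2 * dotp (x - y) (x - y) <= dotp (grad f y) (x - y).
Proof.
move=> fc df; rewrite -derive_grad//.
apply: (@derive_ge _ _ _ _ (rho / 2 * dotp (x - y) (x - y))).
  exact: diff_derivable.
move=> t t0 t1; have := fc x y t (ltW t0) (ltW t1).
have -> : t *: x + (1 - t) *: y = y + t *: (x - y).
  by rewrite scalerBl scale1r scalerBr addrCA addrA; congr (_ + _); rewrite addrC.
rewrite sqr_enorm; set q := dotp _ _; set p := f (y + _); lra.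
Qed.

Lemma derive_le f x v (a : R) : differentiable f x ->
  (forall t, 0 < t -> t < 1 -> f (x + t *: v) - f x <= t * a) ->
  dotp (grad f x) v <= a.
Proof.
move=> df fx; have dfv : derivable f x v by exact: diff_derivable.
rewrite -derive_grad// -lerN2 -deriveN//.
apply: (@derive_ge _ _ _ _ 0); first exact: derivableN.
by move=> t t0 t1; rewrite mul0r subr0 mulrN -opprD lerN2 fx.
Qed.

End Derivative.

(** * Compactness, maximizers and projections *)

Lemma continuous_trmx (R : realType) m n :
  continuous (@trmx R m n : 'M[R]_(m, n) -> 'M[R]_(n, m)).
Proof.
move=> x P [B Bx BP]; exists (fun i j => B j i) => [i j|y By].
  by have := Bx j i; rewrite mxE.
by apply: BP => i j; rewrite mxE; exact: By.
Qed.

(* In [continuous f] with [f] on ['cV[R]_d], [nbhs] is inferred through the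
   filtered structure of matrices, which instance search does not match with
   [nbhs_filter]. *)
#[local] Instance nbhs_cV_filter (R : realType) d (x : 'cV[R]_d) :
  Filter (nbhs x) := @nbhs_filter 'cV[R]_d x.

Section Maximum.
Variables (R : realType) (d : nat).
Implicit Types (X : set 'cV[R]_d) (f : 'cV[R]_d -> R) (c w x y z : 'cV[R]_d).

(** Heine-Borel is applied to row vectors and carried over to columns by transposition, which is
    continuous. *)
Lemma closed_dotp_bounded_compact X (M : R) :
  closed X -> (forall x, X x -> dotp x x <= M) -> compact X.
Proof.
move=> Xcl XM.
have -> : X = trmx @` ((@trmx R 1 d : 'rV[R]_d -> 'cV[R]_d) @^-1` X).
  apply/seteqP; split=> [x Xx|_ [x Xx <-]]//.
  by exists x^T => /=; rewrite trmxK.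
apply: continuous_compact.
  by apply: continuous_subspaceT; exact: continuous_trmx.
apply: bounded_closed_compact; last first.
  by apply: preimage_closed => // x _; exact: continuous_trmx.
(* A coordinate whose square is at most [M] has modulus at most [1 + M]; this avoids a square
   root. *)
exists (1 + M); split=> [|N MN x Xx]; first exact: num_real.
have /(_ _ Xx) := XM; rewrite /dotp => xM.
have M_ge0 : 0 <= M by apply: le_trans xM; exact: (dotp_ge0 x^T).
rewrite /Num.norm/= mx_normrE; apply/bigmax_leP; split=> /=; first lra.
move=> [i j] _ /=; rewrite (ord1 i).
have : x 0 j ^+ 2 <= M.
  apply: le_trans xM; rewrite (bigD1 j)//= mxE expr2 lerDl.
  by apply: sumr_ge0 => k _; rewrite -expr2 sqr_ge0.
move=> {}xM; have : `|x 0 j| ^+ 2 <= M by rewrite -normrX ger0_norm ?sqr_ge0.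
have := normr_ge0 (x 0 j); nra.
Qed.

Lemma continuous_dotp (g h : 'cV[R]_d -> 'cV[R]_d) :
  continuous g -> continuous h -> continuous (fun w => dotp (g w) (h w)).
Proof.
move=> cg ch x.
have cc (k : 'cV[R]_d -> 'cV[R]_d) i :
  continuous k -> continuous (fun w => k w i 0).
  move=> ck y; apply: (@continuous_comp _ _ _ k (fun M : 'cV[R]_d => M i 0)).
    exact: ck.
  exact: coord_continuous.
apply: cvg_big => [|i _]; first exact: add_continuous.
by apply: cvgM; apply: cc.
Qed.

(** The superlevel set of [f] at [x0] within [X] is compact, so [f] has a maximum there; elsewhere
    on [X] its values are below [f x0]. *)
Lemma coercive_attains_max X f x0 (M : R) : closed X -> X x0 -> continuous f ->
  (forall x, X x -> f x0 <= f x -> dotp x x <= M) ->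
  exists2 x, X x & forall w, X w -> f w <= f x.
Proof.
move=> Xcl Xx0 cf XM.
pose Y := X `&` f @^-1` [set r | f x0 <= r].
have Ycl : closed Y.
  apply: closedI => //; apply: preimage_closed => [x _|]; first exact: cf.
  exact: closed_ge.
have Yc : compact Y.
  by apply: (@closed_dotp_bounded_compact _ M) => // x []; exact: XM.
have Y0 : Y !=set0 by exists x0; split=> //=.
have cfY : {within Y, continuous f} by exact: continuous_subspaceT.
have [x /set_mem[Xx fx] xmax] := compact_EVT_max Y0 Yc cfY.
exists x => // w Xw; have [fw|/ltW fw] := leP (f x0) (f w).
  by apply: xmax; rewrite inE.
exact: le_trans fw fx.
Qed.

(** Convexity of [X], in the incremental form suited to differentiating at [x] along [y - x]. *)
Definition segment_closed X := forall x y (t : R), X x -> X y ->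
  0 < t -> t < 1 -> X (x + t *: (y - x)).

Lemma nearest_point_VI X z y : segment_closed X -> X y ->
  (forall w, X w -> dotp (z - y) (z - y) <= dotp (z - w) (z - w)) ->
  forall w, X w -> dotp (z - y) (w - y) <= 0.
Proof.
move=> Xs Xy ymin w Xw; set a := dotp (z - y) (w - y).
set q := dotp (w - y) (w - y).
have q_ge0 : 0 <= q by exact: dotp_ge0.
have H t : 0 < t -> t < 1 -> 2 * a <= t * q.
  move=> t0 t1; have := ymin _ (Xs _ _ _ Xy Xw t0 t1).
  rewrite opprD addrA /a /q; move: (z - y) (w - y) => p r.
  by rewrite !dotpE (dotpC r p); nra.
rewrite leNgt; apply/negP => a_gt0.
(* This [t] lies in (0, 1) and makes [t * q] smaller than [a], contradicting [H]. *)
have := H (a / (a + q + 1)).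
have s_gt0 : 0 < a + q + 1 by lra.
rewrite divr_gt0// ltr_pdivrMr// => /(_ isT); rewrite mul1r.
have -> : a < a + q + 1 by lra.
by move=> /(_ isT); rewrite mulrAC ler_pdivlMr//; nra.
Qed.

Lemma proj_spec X x0 z : closed X -> segment_closed X -> X x0 ->
  X (Defs.proj X z) /\
  forall w, X w -> dotp (z - Defs.proj X z) (w - Defs.proj X z) <= 0.
Proof.
move=> Xcl Xs Xx0.
(* The radius comes from |x|^2 <= 2|z|^2 + 2|z - x|^2, where [x] is no farther from [z] than [x0]
   is. *)
have [x|x Xx|y Xy ymax] := @coercive_attains_max X (fun w => - dotp (z - w) (z - w)) x0
  (2 * dotp z z + 2 * dotp (z - x0) (z - x0)) Xcl Xx0.
- apply: cvgN; apply: (@continuous_dotp (fun w => z - w) (fun w => z - w)) => w.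
    by apply: cvgB; [exact: cvg_cst|exact: cvg_id].
  by apply: cvgB; [exact: cvg_cst|exact: cvg_id].
- rewrite lerN2 => zx.
  apply: le_trans (_ : 2 * dotp z z + 2 * dotp (z - x) (z - x) <= _); last by lra.
  have := dotp_sqrD z (x - z); rewrite addrC subrK.
  by rewrite -(opprB z x) dotpNl dotpNr opprK.
(* A nearest point exists, so [xget] does not return its default 0. *)
have : [set y | X y /\ forall w, X w -> enorm (z - y) <= enorm (z - w)]
    (Defs.proj X z).
  apply: xgetPex; exists y; split=> // w /ymax.
  by rewrite ler_enorm lerN2.
move=> [Xp pmin]; split=> //; apply: nearest_point_VI => // w Xw.
by rewrite -ler_enorm pmin.
Qed.

(** The variational inequality gives |z - y|^2 + |w - y|^2 <= |z - w|^2, so [y] is a nearest point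
    and every other nearest point coincides with it. *)
Lemma proj_eq X z y : X y -> (forall w, X w -> dotp (z - y) (w - y) <= 0) ->
  Defs.proj X z = y.
Proof.
move=> Xy yVI.
have dist w : X w ->
    dotp (z - y) (z - y) + dotp (w - y) (w - y) <= dotp (z - w) (z - w).
  move=> /yVI; have -> : z - w = (z - y) - (w - y).
    by rewrite opprB addrA subrK.
  by move: (z - y) (w - y) => p q; rewrite !dotpE (dotpC q p); lra.
have [Xp pmin] :
    [set y | X y /\ forall w, X w -> enorm (z - y) <= enorm (z - w)]
      (Defs.proj X z).
  apply: xgetPex; exists y; split=> // w /dist.
  by rewrite ler_enorm; have := dotp_ge0 (w - y); lra.
apply/eqP; rewrite -subr_eq0; apply/eqP/dotp_eq0.
have := pmin _ Xy; rewrite ler_enorm.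
by have := dist _ Xp; have := dotp_ge0 (Defs.proj X z - y); lra.
Qed.

(** The solution maximizes f - <c, .> over [X]. If this function is at least its value at [x0],
    strong concavity gives (rho/2)|u|^2 <= <g, u> for u = x - x0, which bounds [x]. *)
Lemma concave_VI_solution X f rho c x0 : 0 < rho -> strongly_concave rho f ->
  (forall x, differentiable f x) -> closed X -> segment_closed X -> X x0 ->
  exists2 x, X x & forall w, X w -> dotp (grad f x - c) (w - x) <= 0.
Proof.
move=> rho_gt0 fc df Xcl Xs Xx0; set g := grad f x0 - c.
have [w|x Xx|x Xx xmax] := @coercive_attains_max X (fun w => f w - dotp c w) x0
  (2 * ((rho / 2) ^- 2 * dotp g g) + 2 * dotp x0 x0) Xcl Xx0.
- apply: cvgB; first exact: (differentiable_continuous (df w)).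
  by apply: (@continuous_dotp (fun=> c) id) => y; [exact: cvg_cst|exact: cvg_id].
- move=> fx; set u := x - x0.
  have h : rho / 2 * dotp u u <= dotp g u.
    have := strongly_concave_grad x fc (df x0).
    by rewrite /g /u; move: fx; rewrite !dotpE; lra.
  have u_le := dotp_sqr_le (divr_gt0 rho_gt0 (ltr0Sn R 1)) h.
  have -> : x = u + x0 by rewrite subrK.
  by apply: le_trans (dotp_sqrD u x0) _; rewrite lerD2r ler_pM2l.
exists x => // w Xw; rewrite dotpDl dotpNl subr_le0.
apply: derive_le => // t t0 t1.
by have := xmax _ (Xs _ _ _ Xx Xw t0 t1); rewrite dotpDr dotpZr; lra.
Qed.

End Maximum.

(** * Closedness and convexity of the feasible set *)

Lemma feasible_closed (R : realType) d m (H : 'I_m -> 'cV[R]_d -> R) :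
  (forall i, continuous (H i)) -> closed (feasible H).
Proof.
move=> cH; have -> : feasible H = \bigcap_i (H i @^-1` [set r | r <= 0]).
  by apply/seteqP; split=> x Hx i => [_|]; exact: Hx.
apply: closed_bigI => i _; apply: preimage_closed => [x _|]; first exact: cH.
exact: closed_le.
Qed.

Lemma feasible_segment_closed (R : realType) d m (H : 'I_m -> 'cV[R]_d -> R) :
  (forall i, convex_function [set: convex_lmodType 'cV[R]_d] (H i)) ->
  segment_closed (feasible H).
Proof.
move=> cH x y t Hx Hy t0 t1 i.
pose s : {i01 R} := Itv01 (ltW t0) (ltW t1).
(* The points are swapped because the weight [s] falls on the first argument of [conv]. *)
have := @cH i s y x; rewrite !inE => /(_ I I).
have -> : conv s (y : convex_lmodType 'cV[R]_d) x = x + t *: (y - x).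
  have -> : x + t *: (y - x) = t *: y + (1 - t) *: x.
    by rewrite scalerBl scale1r scalerBr addrCA.
  by [].
move/le_trans; apply; rewrite convRE.
change (t * H i y + (1 - t) * H i x <= 0).
by have := Hx i; have := Hy i; nra.
Qed.

(** * Variational characterization of [xstar] and [xhat] *)

Section FirstOrderConditions.
Variables (R : realType) (d1 d2 : nat) (H0 : 'cV[R]_d1 -> R).
Variables (X : set 'cV[R]_d1) (A : 'M[R]_(d2, d1)) (rho : R).
Hypothesis rho_gt0 : 0 < rho.
Hypothesis H0_concave : strongly_concave rho H0.
Hypothesis H0_diff : forall x, differentiable H0 x.

(** Add the first-order inequalities at [x] and at [y]; the two terms in rho/2 combine. *)
Lemma strongly_concave_grad_antitone x y :
  rho * dotp (x - y) (x - y) <= - dotp (grad H0 x - grad H0 y) (x - y).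
Proof.
have := strongly_concave_grad y H0_concave (H0_diff x).
have := strongly_concave_grad x H0_concave (H0_diff y).
rewrite -(opprB x y) !dotpE; lra.
Qed.

Lemma xstarP lambda : grad H0 (xstar H0 A lambda) = A^T *m lambda.
Proof.
apply/eqP; rewrite -subr_eq0; apply/eqP.
rewrite -/([set x | grad H0 x - A^T *m lambda = 0] (xstar H0 A lambda)).
apply: xgetPex.
have segT : segment_closed [set: 'cV[R]_d1] by [].
have [x _ xVI] := concave_VI_solution (A^T *m lambda)
  rho_gt0 H0_concave H0_diff closedT segT (I : [set: 'cV[R]_d1] 0).
exists x; apply: dotp_eq0; set g := _ - _.
(* On the whole space the direction [g] itself is admissible, which forces |g|^2 <= 0. *)
by have := xVI (x + g) I; rewrite addrAC subrr add0r; have := dotp_ge0 g; lra.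
Qed.

Hypothesis X_closed : closed X.
Hypothesis X_segment : segment_closed X.
Hypothesis X_neq0 : X !=set0.

(** A solution of the inequality is a fixed point by [proj_eq], so [xhat] is a genuine fixed point;
    [proj_spec] then returns the inequality for it. *)
Lemma xhatP lambda (x := xhat H0 X A lambda) :
  X x /\ forall w, X w -> dotp (grad H0 x - A^T *m lambda) (w - x) <= 0.
Proof.
have shiftK (a b c : 'cV[R]_d1) : a + b - c - a = b - c.
  by rewrite -[a + b - c]addrA [_ - a]addrC addKr.
have [x0 Xx0] := X_neq0.
have [y Xy yVI] := concave_VI_solution (A^T *m lambda)
  rho_gt0 H0_concave H0_diff X_closed X_segment Xx0.
have xE : x = Defs.proj X (x + grad H0 x - A^T *m lambda).
  rewrite -/([set x | x = Defs.proj X (x + grad H0 x - A^T *m lambda)] x).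
  apply: xgetPex; exists y => /=; apply/esym/proj_eq => // w Xw.
  by rewrite shiftK yVI.
have [] := proj_spec (x + grad H0 x - A^T *m lambda) X_closed X_segment Xx0.
by rewrite -xE shiftK.
Qed.

End FirstOrderConditions.

Theorem lemma5p6 (R : realType) (d1 d2 m : nat)
    (H0 : 'cV[R]_d1 -> R) (H : 'I_m -> 'cV[R]_d1 -> R)
    (A : 'M[R]_(d2, d1)) (b0 : 'cV[R]_d2) (rho L : R)
    (rho_gt0 : 0 < rho) (L_gt0 : 0 < L)
    (H0_concave : strongly_concave rho H0)
    (H0_smooth : L_smooth L H0)
    (H_C1 : forall i, continuously_differentiable (H i))
    (H_convex : forall i, convex_function [set: convex_lmodType 'cV[R]_d1] (H i))
    (slater : exists x : 'cV[R]_d1, (forall i, H i x < 0) /\ A *m x = b0)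
    (A_full_rank : row_free A) :
  strongly_monotone (fun lambda => - (A *m xstar H0 A lambda)) /\
  cocoercive (fun lambda => - (A *m xhat H0 (feasible H) A lambda)).
Proof.
have dH0 := H0_smooth.1.
have Xcl : closed (feasible H).
  by apply: feasible_closed => i x; exact/differentiable_continuous/(H_C1 i).1.
have Xs := feasible_segment_closed H_convex.
have X0 : feasible H !=set0.
  by have [x [Hx _]] := slater; exists x => i; exact/ltW.
split.
- have [K K_gt0 KP] := mulmx_dotp_bounded (pinvmx A)^T.
  (* The constant combines rho|x - y|^2 as a lower bound with |u - v|^2 <= K L^2 |x - y|^2. *)
  exists (rho / L ^+ 2 / K) => [|u v].
    by rewrite !divr_gt0// exprn_gt0.
  set x := xstar H0 A u; set y := xstar H0 A v.
  rewrite sqr_enorm -opprD -mulmxBr dotpNl dotp_mulmx.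
  have gE : grad H0 x - grad H0 y = A^T *m (u - v).
    by rewrite !(xstarP A rho_gt0 H0_concave dH0) mulmxBr.
  rewrite -gE (dotpC (x - y)).
  apply: le_trans (strongly_concave_grad_antitone H0_concave dH0 x y).
  (* Full row rank makes [pinvmx A] a right inverse of [A], so its transpose is a left inverse of
     [A^T]. *)
  have uvE : u - v = (pinvmx A)^T *m (grad H0 x - grad H0 y).
    by rewrite gE mulmxA -trmx_mul mulmxVp// trmx1 mul1mx.
  have : dotp (u - v) (u - v) <= K * (L ^+ 2 * dotp (x - y) (x - y)).
    rewrite {1 2}uvE; apply: le_trans (KP _) _; rewrite ler_pM2l//.
    rewrite -!sqr_enorm -exprMn; apply: lerXn2r; last exact: H0_smooth.2.
    + by rewrite nnegrE sqrtr_ge0.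
    + by rewrite nnegrE mulr_ge0 ?sqrtr_ge0// ltW.
  by move=> uv_le; rewrite -!mulrA ler_pM2l// !ler_pdivrMl ?exprn_gt0.
- have [K K_gt0 KP] := mulmx_dotp_bounded A.
  exists (rho / K) => [|u v]; first by rewrite divr_gt0.
  rewrite sqr_enorm -opprD -mulmxBr !(dotpNl, dotpNr) opprK.
  have := xhatP A rho_gt0 H0_concave dH0 Xcl Xs X0 u.
  have := xhatP A rho_gt0 H0_concave dH0 Xcl Xs X0 v.
  move: (xhat _ _ _ u) (xhat _ _ _ v) => x y [Xy yVI] [Xx xVI].
  apply: (@le_trans _ _ (rho * dotp (x - y) (x - y))).
    by rewrite -mulrA ler_pM2l// ler_pdivrMl.
  apply: le_trans (strongly_concave_grad_antitone H0_concave dH0 x y) _.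
  rewrite dotp_mulmx mulmxBr.
  (* Each inequality is tested at the other solution; their sum compares the gradient difference
     with A^T (u - v). *)
  have := xVI _ Xy; have := yVI _ Xx; rewrite -(opprB x y).
  move: (grad H0 x) (grad H0 y) (A^T *m u) (A^T *m v) (x - y) => g h a b w.
  by rewrite !dotpE !(dotpC w); lra.
Qed.
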